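(* The set of all roots (in $\mathbb{C}$) of reliability polynomials $\mathrm{Rel}(\mathcal{C};q)$, where $\mathcal{C}$ ranges over all shellable simplicial complexes, is dense in the complex plane.
   Context: A (simplicial) complex on a nonempty finite set $X$ is a collection of subsets of $X$ (faces) closed under taking subsets; maximal faces are facets; the dimension is the largest cardinality of a face; the complex is purely $d$-dimensional if all facets have cardinality $d$. The reliability polynomial is $\mathrm{Rel}(\mathcal{C};q)=\sum_{\sigma\in\mathcal{C}} q^{|\sigma|}(1-q)^{|X\setminus\sigma|}$. For a set $\sigma$, $\overline{\sigma}$ denotes its power set. A nonempty purely $d$-dimensional complex is shellable if its facets can be ordered $\sigma_1,\ldots,\sigma_t$ so that for each $j\ge 2$ the complex $\overline{\sigma_j}\cap\bigcup_{i<j}\overline{\sigma_i}$ is purely $(d-1)$-dimensional. *)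

(* Defs.v *)
From mathcomp Require Import all_boot all_order all_algebra.
From mathcomp Require Import all_classical all_reals all_analysis.
From mathcomp Require Export complex.

Set Implicit Arguments.
Unset Strict Implicit.
Unset Printing Implicit Defensive.

Import GRing.Theory.

Section Complexes.
Variable T : finType.
Implicit Types (C : {set {set T}}) (sigma tau : {set T}).

Definition simplicial_complex C : Prop :=
  forall sigma tau, sigma \in C -> tau \subset sigma -> tau \in C.

Definition facets C : {set {set T}} :=
  [set sigma | maxset (fun tau => tau \in C) sigma]%SET.

(* Dimensions are cardinalities of faces, with no shift by one. *)
Definition purely_dimensional (d : nat) C : Prop :=
  forall sigma, sigma \in facets C -> #|sigma| = d.

(* The facets are numbered from 0, so the first one carries no condition.
   The predecessor d.-1 is never truncated: if there are at least two
   facets, all of cardinality d, then d > 0. *)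
Definition shelling (d : nat) C (s : seq {set T}) : Prop :=
  [/\ uniq s, s =i facets C &
      forall j, 0 < j < size s ->
        purely_dimensional d.-1
          (powerset (nth finset.set0 s j)
             :&: \bigcup_(tau <- take j s) powerset tau)%SET].

Definition shellable C : Prop :=
  C <> finset.set0 /\
  exists d, purely_dimensional d C /\ exists s, shelling d C s.

Definition Rel (K : comNzRingType) C : {poly K} :=
  (\sum_(sigma in C) 'X^#|sigma| * (1 - 'X) ^+ #|~: sigma|%SET)%R.

End Complexes.

Arguments Rel {T} K C.

(* Main.v *)
(* Whiskering: a complex D on V gives a complex on V + V with faces the pairs
   (A, B) where A is a face of D and B is disjoint from A.  It is shelled by its
   facets (A, ~: A) in order of increasing #|A|, and its reliability polynomial
   is (1 - q)^#|V| times the face polynomial of D.  It is therefore enough to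
   see that roots of face polynomials are dense.

   Joins and disjoint unions of complexes show that, for all naturals n_k and m,
   u^j + sum_(k < d) n_k (u^k - 1) with u = 1 + m q is a face polynomial in q.
   If u is not real and `|u| >= 3, the nonnegative real combinations of the
   numbers u^k - 1, k < d, cover the whole plane for some d.  So for any j there
   are reals n_k >= 0 making the expression vanish at u; rounding them down
   leaves a value bounded independently of j, hence below 2^j for large j, and a
   monic polynomial of degree j with such a small value has a root at distance
   less than 2 from u.  In terms of q, this distance is less than 2 / m. *)

Require Import Defs.
From mathcomp Require Import all_boot all_order all_algebra.
From mathcomp Require Import zify ring lra.

Set Implicit Arguments.
Unset Strict Implicit.
Unset Printing Implicit Defensive.

Import Order.TTheory GRing.Theory Num.Theory.

(** * Subsets of a disjoint union as pairs of subsets *)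

Section SumSets.
Variables V W : finType.

Definition sum_set (p : {set V} * {set W}) : {set V + W} :=
  [set x | match x with inl v => v \in p.1 | inr w => w \in p.2 end].

Definition set_sum (s : {set V + W}) : {set V} * {set W} :=
  (inl @^-1: s, inr @^-1: s).

Lemma sum_setK : cancel sum_set set_sum.
Proof.
by case=> A B; congr pair; apply/setP => x; rewrite !inE.
Qed.

Lemma set_sumK : cancel set_sum sum_set.
Proof. by move=> s; apply/setP => -[] x; rewrite !inE. Qed.

Lemma sum_set_bij : bijective sum_set.
Proof. exact: Bijective sum_setK set_sumK. Qed.

Lemma sum_set_sub (A A' : {set V}) (B B' : {set W}) :
  (sum_set (A, B) \subset sum_set (A', B')) = (A \subset A') && (B \subset B').
Proof.
apply/subsetP/andP => [sAB | [/subsetP sA /subsetP sB] [] x].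
- by split; apply/subsetP => x xA; [move: (sAB (inl x)) | move: (sAB (inr x))];
    rewrite !inE; apply.
- by rewrite !inE; apply: sA.
- by rewrite !inE; apply: sB.
Qed.

Lemma card_sum_set (A : {set V}) (B : {set W}) :
  #|sum_set (A, B)| = #|A| + #|B|.
Proof.
by rewrite -sum1_card big_sumType -!sum1_card /=; congr (_ + _);
  apply: eq_bigl => x; rewrite inE.
Qed.

Lemma setC_sum_set (A : {set V}) (B : {set W}) :
  ~: sum_set (A, B) = sum_set (~: A, ~: B).
Proof. by apply/setP => -[] x; rewrite !inE. Qed.

End SumSets.

Lemma sum_powerset_expr (K : comNzRingType) (V : finType) (S : {set V})
    (x y : K) :
  (\sum_(B in powerset S) x ^+ #|B| * y ^+ #|S :\: B| = (x + y) ^+ #|S|)%R.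
Proof.
(* Outside [S] the factor [F i + G i] is [0 + 1], so the product can run over all of [V], and only
   subsets of [S] survive in its expansion. *)
pose F i := (if i \in S then x else 0)%R.
pose G i := (if i \in S then y else 1)%R.
transitivity (\prod_(i : V) (F i + G i))%R; last first.
  rewrite (bigID (mem S)) /= [X in (_ * X)%R]big1 ?mulr1; last first.
    by move=> i iS; rewrite /F /G (negPf iS) add0r.
  by rewrite -prodr_const; apply: eq_bigr => i iS; rewrite /F /G iS.
rewrite bigA_distr [RHS](bigID (mem (powerset S))) /=.
rewrite [X in (_ + X)%R]big1 ?addr0 => [|B]; last first.
  rewrite powersetE => /subsetPn[v vB vS].
  by rewrite (bigD1 v) //= vB /F (negPf vS) mul0r.
apply: eq_bigr => B; rewrite powersetE => /subsetP BS.
rewrite (bigID (mem B)) /= -!prodr_const; congr (_ * _)%R.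
  by apply: eq_bigr => i iB; rewrite iB /F BS.
rewrite [RHS](bigID (mem S)) /= [X in (_ * X)%R]big1 ?mulr1; last first.
  by move=> i /andP[/negPf-> /negPf iS]; rewrite /G iS.
apply: eq_big => i; first by rewrite inE.
by rewrite inE => /andP[/negPf-> iS]; rewrite /G iS.
Qed.

(** * Face polynomials and their closure properties *)

Section FacePolynomials.
Variable K : comNzRingType.
Local Open Scope ring_scope.

Definition face_poly (V : finType) (D : {set {set V}}) : {poly K} :=
  \sum_(s in D) 'X^#|s|.

(** [set0 \in D] excludes the void complex and makes the constant coefficient 1. *)
Definition is_face_poly (p : {poly K}) : Prop :=
  exists (V : finType) (D : {set {set V}}),
    [/\ (0 < #|V|)%N, simplicial_complex D, set0 \in D & face_poly D = p].

Lemma is_face_poly_points (m : nat) : is_face_poly (1 + m%:R *: 'X).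
Proof.
(* [None] lies in no face; it keeps the ground set nonempty when [m = 0]. *)
pose V := option 'I_m.
pose D :=
  [set s : {set V} | (s == set0) || [exists i : 'I_m, s == [set Some i]]].
exists V, D; split.
- by rewrite card_option.
- move=> s t; rewrite !inE => /orP[/eqP-> | /existsP[i /eqP->]].
    by rewrite subset0 => ->.
  rewrite subset1 => /orP[/eqP-> | ->//]; apply/orP; right.
  by apply/existsP; exists i.
- by rewrite inE eqxx.
have -> : D = set0 |: [set [set Some i] | i in 'I_m].
  apply/setP => s; rewrite !inE; congr (_ || _).
  by apply/existsP/imsetP => -[i0]; [move/eqP=> -> | move=> _ ->]; exists i0.
rewrite /face_poly big_setU1 /=; last first.
  apply/imsetP => -[i _ /setP/(_ (Some i))].
  by rewrite !inE eqxx.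
rewrite cards0 expr0; congr (_ + _).
rewrite big_imset /=; last by move=> i j _ _ /set1_inj[].
under eq_bigr do rewrite cards1 expr1.
by rewrite sumr_const card_ord scaler_nat.
Qed.

(** Realized by the join: faces are pairs of faces, and cardinalities add. *)
Lemma is_face_polyM (p q : {poly K}) :
  is_face_poly p -> is_face_poly q -> is_face_poly (p * q).
Proof.
move=> [V [D [V0 DP D0 <-]]] [W [E [W0 EP E0 <-]]].
pose J := [set s : {set V + W} |
  ((set_sum s).1 \in D) && ((set_sum s).2 \in E)].
have inJ A B : (sum_set (A, B) \in J) = (A \in D) && (B \in E).
  by rewrite inE sum_setK.
exists (V + W)%type, J; split.
- by rewrite card_sum addn_gt0 V0.
- move=> s t; rewrite -(set_sumK s) -(set_sumK t).
  case: (set_sum s) => A B; case: (set_sum t) => A' B'.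
  rewrite sum_set_sub !inJ => /andP[AD BE] /andP[sA sB].
  by rewrite (DP A A') // (EP B B').
- rewrite (_ : set0 = sum_set (set0, set0)) ?inJ ?D0 //.
  by apply/setP => -[] x; rewrite !inE.
rewrite /face_poly (reindex (@sum_set V W)) /=; last first.
  by apply: onW_bij; apply: sum_set_bij.
rewrite big_distrlr pair_big /=; apply: eq_big => -[A B].
  exact: inJ.
by rewrite card_sum_set exprD.
Qed.

(** Realized by the disjoint union: only the empty face is shared, hence the [- 1]. *)
Lemma is_face_polyU (p q : {poly K}) :
  is_face_poly p -> is_face_poly q -> is_face_poly (p + (q - 1)).
Proof.
move=> [V [D [V0 DP D0 <-]]] [W [E [W0 EP E0 <-]]].
pose U := [set sum_set (A, set0 : {set W}) | A in D].
pose U' := [set sum_set (set0 : {set V}, B) | B in E :\ set0].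
have sub0P (T : finType) (A : {set T}) : A \subset set0 -> A = set0.
  by rewrite subset0 => /eqP.
exists (V + W)%type, (U :|: U'); split.
- by rewrite card_sum addn_gt0 V0.
- move=> s t; rewrite -(set_sumK t); case: (set_sum t) => A' B'.
  rewrite !inE => /orP[] /imsetP[A AD ->]; rewrite sum_set_sub => /andP[sA sB].
    apply/orP; left; apply/imsetP; exists A'; first exact: DP AD sA.
    by rewrite (sub0P _ _ sB).
  move: AD; rewrite !inE => /andP[_ AE].
  rewrite (sub0P _ _ sA); have [-> | B0] := eqVneq B' set0; apply/orP.
    by left; apply/imsetP; exists set0.
  by right; apply/imsetP; exists B'; rewrite // !inE B0; apply: EP sB.
- rewrite inE; apply/orP; left; apply/imsetP; exists set0 => //.
  by apply/setP => -[] x; rewrite !inE.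
rewrite /face_poly (eq_bigl [in [predU U & U']]) => [|s]; last by rewrite !inE.
rewrite bigU /=; last first.
  rewrite disjoints_subset; apply/subsetP => _ /imsetP[A AD ->].
  rewrite inE; apply/imsetP => -[B]; rewrite !inE => /andP[B0 _].
  by move/(can_inj (@sum_setK V W)) => [_ B00]; rewrite B00 eqxx in B0.
rewrite !big_imset /=;
  try by move=> ? ? _ _ /(can_inj (@sum_setK V W)) [].
rewrite (big_setD1 _ E0) /= cards0 expr0 [1 + _]addrC addrK.
by congr (_ + _); apply: eq_bigr => A _; rewrite card_sum_set cards0 ?addn0.
Qed.

Lemma is_face_poly1 : is_face_poly 1.
Proof. by have := is_face_poly_points 0; rewrite scale0r addr0. Qed.

Lemma is_face_polyX (p : {poly K}) n : is_face_poly p -> is_face_poly (p ^+ n).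
Proof.
move=> pF; elim: n => [|n IH]; first exact: is_face_poly1.
by rewrite exprS; apply: is_face_polyM.
Qed.

(** Disjoint union with [c k] copies of a complex for each [q k]. *)
Lemma is_face_poly_sum (p : {poly K}) (q : nat -> {poly K}) (c : nat -> nat) d :
  is_face_poly p -> (forall k, is_face_poly (q k)) ->
  is_face_poly (p + \sum_(k < d) (c k)%:R * (q k - 1)).
Proof.
move=> pF qF; elim: d => [|d IH]; first by rewrite big_ord0 addr0.
rewrite big_ord_recr addrA /=; set r := p + _ in IH *.
elim: (c d) => [|n IHn]; first by rewrite mul0r addr0.
rewrite -addn1 natrD mulrDl mul1r addrA.
exact: is_face_polyU.
Qed.

End FacePolynomials.

(** * Whiskering and shellability *)

Section Whiskering.
Variables (V : finType) (D : {set {set V}}).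

Definition whisker : {set {set V + V}} :=
  [set s | ((set_sum s).1 \in D) && [disjoint (set_sum s).1 & (set_sum s).2]].

Definition whisker_facet (A : {set V}) : {set V + V} := sum_set (A, ~: A).

Lemma in_whisker (A B : {set V}) :
  (sum_set (A, B) \in whisker) = (A \in D) && (B \subset ~: A).
Proof. by rewrite inE sum_setK /= disjoint_sym disjoints_subset. Qed.

(** For fixed [A], summing over [B] inside [~: A] leaves the factor
    [('X + (1 - 'X)) ^+ #|~: A| = 1]. *)
Lemma Rel_whisker (K : comNzRingType) :
  (Rel K whisker = (1 - 'X) ^+ #|V| * face_poly K D)%R.
Proof.
rewrite /Rel (reindex (@sum_set V V)) /=; last first.
  by apply: onW_bij; apply: sum_set_bij.
pose F (A B : {set V}) : {poly K} :=
  ('X^(#|A| + #|B|) * (1 - 'X) ^+ (#|~: A| + #|~: B|))%R.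
transitivity (\sum_(A in D) \sum_(B in powerset (~: A)) F A B)%R.
  rewrite pair_big_dep /=; apply: eq_big => -[A B].
    by rewrite in_whisker powersetE.
  by rewrite setC_sum_set !card_sum_set.
rewrite /face_poly mulr_sumr; apply: eq_bigr => A _.
under eq_bigr => B BA.
  have -> : F A B = ((1 - 'X) ^+ #|V| * 'X^#|A| *
                     ('X^#|B| * (1 - 'X) ^+ #|~: A :\: B|))%R.
    rewrite powersetE in BA; rewrite /F cardsD (setIidPr BA).
    have -> : #|~: A| + #|~: B| = #|V| + (#|~: A| - #|B|).
      by have := cardsC B; have := subset_leq_card BA; lia.
    by rewrite !exprD; ring.
  over.
by rewrite -mulr_sumr sum_powerset_expr [('X + _)%R]addrC subrK expr1n mulr1.
Qed.

Hypotheses (DP : simplicial_complex D) (D0 : set0 \in D).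

Lemma whisker_complex : simplicial_complex whisker.
Proof.
move=> s t; rewrite -(set_sumK s) -(set_sumK t).
case: (set_sum s) => A B; case: (set_sum t) => A' B'.
rewrite sum_set_sub !in_whisker => /andP[AD BA] /andP[sA sB].
rewrite (DP AD sA) (subset_trans sB) // (subset_trans BA) // setCS.
exact: sA.
Qed.

Lemma whisker_facet_inj : injective whisker_facet.
Proof. by move=> A B /(can_inj (@sum_setK V V)) []. Qed.

Lemma card_whisker_facet A : #|whisker_facet A| = #|V|.
Proof. by rewrite card_sum_set cardsC. Qed.

(** A face [(A, B)] lies in [(A, ~: A)], and these are pairwise incomparable since enlarging [A]
    shrinks [~: A]. *)
Lemma facets_whisker : facets whisker = [set whisker_facet A | A in D].
Proof.
apply/setP => s; rewrite inE; apply/maxsetP/imsetP.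
  rewrite -(set_sumK s); case: (set_sum s) => A B [].
  rewrite in_whisker => /andP[AD BA] smax; exists A => //.
  by apply/esym/smax; rewrite /whisker_facet ?in_whisker ?sum_set_sub subxx ?AD.
move=> [A AD ->]; split; first by rewrite in_whisker AD /=.
move=> t; rewrite -(set_sumK t); case: (set_sum t) => A' B'.
rewrite in_whisker sum_set_sub => /andP[_ sB'] /andP[sA sC].
have eA : A' = A.
  by apply/eqP; rewrite eqEsubset sA -setCS (subset_trans sC).
by rewrite eA in sB' *; congr sum_set; congr pair; apply/eqP;
  rewrite eqEsubset sB'.
Qed.

(** An earlier facet comes from some [B] other than [A] with [#|B| <= #|A|], so some [v] in [A] is
    not in [B]. A face shared with it misses [inl v], hence lies in the facet of [A] without
    [inl v], which has the required cardinality. *)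
Lemma whisker_shellable : shellable whisker.
Proof.
split.
  by move/setP/(_ (whisker_facet set0)); rewrite in_whisker D0 subxx inE.
exists #|V|; split.
  move=> s; rewrite facets_whisker => /imsetP[A _ ->].
  exact: card_whisker_facet.
pose le := [rel A B : {set V} | #|A| <= #|B|].
pose r := sort le (enum D).
have le_tr : transitive le by move=> ? ? ?; apply: leq_trans.
have le_refl : reflexive le by move=> ? /=.
have r_sorted : sorted le r by apply: sort_sorted => A B /=; apply: leq_total.
have mem_r A : (A \in r) = (A \in D) by rewrite mem_sort mem_enum.
have r_uniq : uniq r by rewrite sort_uniq enum_uniq.
exists (map whisker_facet r); split.
- by rewrite map_inj_uniq //; apply: whisker_facet_inj.
- move=> s; rewrite facets_whisker.
  by apply/mapP/imsetP => -[A]; rewrite ?mem_r => AD ->; exists A;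
    rewrite ?mem_r.
move=> j; rewrite size_map => /andP[_ jr].
rewrite (nth_map set0) // -map_take; set A := nth set0 r j.
have AD : A \in D by rewrite -mem_r mem_nth.
have inU (P : seq {set V}) s :
    (s \in \bigcup_(tau <- map whisker_facet P) powerset tau) =
    has (fun B => s \subset whisker_facet B) P.
  elim: P => [|B P IH]; first by rewrite big_nil inE.
  by rewrite big_cons /= !inE IH.
move=> s; rewrite inE => /maxsetP[]; rewrite inE powersetE inU.
move=> /andP[sA /hasP[B Br sB]] smax.
have /index_ltn ltBj := Br.
have BR : B \in r by apply: mem_take Br.
have leBA : #|B| <= #|A|.
  have := sorted_leq_nth le_tr le_refl set0 r_sorted (index B r) j.
  by rewrite !inE index_mem nth_index // => /(_ BR jr (ltnW ltBj)).
have neBA : A != B.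
  by apply/eqP => eAB; move: ltBj; rewrite -eAB index_uniq // ltnn.
have /subsetPn[v vA vB] : ~~ (A \subset B).
  by apply: contra neBA => sAB; rewrite eqEcard sAB.
have sAv : s \subset whisker_facet A :\ inl v.
  rewrite subsetD1 sA /=; apply: contra vB => /(subsetP sB).
  by rewrite inE.
rewrite -(smax (whisker_facet A :\ inl v)) //.
  have := cardsD1 (inl v) (whisker_facet A).
  by rewrite card_whisker_facet inE /= vA => ->.
(* This subset [(A :\ v, ~: A)] lies in the facet of [A :\ v], which comes earlier because [A :\ v]
   is a strictly smaller face. *)
rewrite inE powersetE subsetDl inU; apply/hasP; exists (A :\ v).
  have AvD : A :\ v \in r by rewrite mem_r (DP AD) // subsetDl.
  rewrite in_take // ltnNge; apply/negP => le_j.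
  have := sorted_leq_nth le_tr le_refl set0 r_sorted j (index (A :\ v) r).
  rewrite !inE index_mem nth_index // -/A /= => /(_ jr AvD le_j).
  by rewrite [X in X <= _](cardsD1 v) vA add1n ltnn.
apply/subsetP => -[] x; rewrite !inE //=.
by rewrite negb_and orbC => ->.
Qed.

End Whiskering.

(* Imported only here: classical sets shadow the notations of finite sets. *)
From mathcomp Require Import all_classical all_reals all_analysis.
Import numFieldNormedType.Exports.

(** * Nonnegative combinations of the numbers [u ^+ k - 1] *)

Section ComplexPowers.
Variable R : realType.
Local Open Scope ring_scope.
Local Open Scope complex_scope.
Implicit Types u v w z : R[i].

Lemma Re_sqr u : complex.Re (u ^+ 2) = complex.Re u ^+ 2 - complex.Im u ^+ 2.
Proof. by case: u => a b; rewrite !expr2. Qed.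

Lemma Im_sqr u : complex.Im (u ^+ 2) = 2 * complex.Re u * complex.Im u.
Proof. by case: u => a b; rewrite expr2 /=; ring. Qed.

(* Squaring at least doubles [`|Im u / Re u|] as long as the real parts stay
   positive. *)
Lemma exists_expr_Re_le0 u :
  complex.Im u != 0 -> exists k : nat, complex.Re (u ^+ k) <= 0.
Proof.
move=> Iu0.
(* After [n] doublings [|Im|] reaches [|Re|]; one more squaring makes the real part nonpositive. *)
have [n] : exists n : nat, complex.Re u ^+ 2 <= 4 ^+ n * complex.Im u ^+ 2.
  pose x := complex.Re u ^+ 2 / complex.Im u ^+ 2.
  exists (Num.bound x).
  rewrite -ler_pdivrMr ?exprn_even_gt0 // -/x ltW //.
  apply: lt_le_trans (upper_nthrootP (leqnn _)) _.
  by rewrite lerXn2r // ?nnegrE ?ler0n // ler_nat.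
elim: n u Iu0 => [|n IH] u Iu0 le_u.
  by exists 2%N; rewrite Re_sqr; rewrite mul1r in le_u; lra.
have [Ru0 | Ru0] := leP (complex.Re u) 0; first by exists 1%N.
have [R20 | R20] := leP (complex.Re (u ^+ 2)) 0; first by exists 2%N.
have [||k] := IH (u ^+ 2).
- by rewrite Im_sqr !mulf_neq0 // ?pnatr_eq0 // gt_eqF.
- move: R20; rewrite Im_sqr Re_sqr [4 ^+ _]exprS in le_u * => R20.
  move: le_u R20; set a := complex.Re u; set b := complex.Im u => le_u R20.
  have b2 : 0 <= b ^+ 2 by exact: sqr_ge0.
  apply: (@le_trans _ _ ((a ^+ 2) ^+ 2)); first by rewrite lerXn2r ?nnegrE; lra.
  have -> : 4 ^+ n * (2 * a * b) ^+ 2 = a ^+ 2 * (4 * 4 ^+ n * b ^+ 2) by ring.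
  by rewrite [(a ^+ 2) ^+ 2]expr2 ler_wpM2l ?sqr_ge0.
- by rewrite -exprM => Hk; exists (2 * k)%N.
Qed.

(** Coefficients are nonnegative because, rounded down, they will count copies of complexes. *)
Definition power_cone (d : nat) u z : Prop :=
  exists2 a : nat -> R, (forall k, 0 <= a k)
    & z = \sum_(k < d) (a k)%:C * (u ^+ k - 1).

Lemma power_coneD d u z z' :
  power_cone d u z -> power_cone d u z' -> power_cone d u (z + z').
Proof.
move=> [a a0 ->] [b b0 ->]; exists (fun k => a k + b k).
  by move=> k; rewrite addr_ge0.
by rewrite -big_split; apply: eq_bigr => k _; rewrite rmorphD /= mulrDl.
Qed.

Lemma power_coneZ d u z (c : R) :
  0 <= c -> power_cone d u z -> power_cone d u (c%:C * z).
Proof.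
move=> c0 [a a0 ->]; exists (fun k => c * a k).
  by move=> k; rewrite mulr_ge0.
by rewrite mulr_sumr; apply: eq_bigr => k _; rewrite rmorphM /= mulrA.
Qed.

Lemma power_cone_expr d u k : (k < d)%N -> power_cone d u (u ^+ k - 1).
Proof.
move=> kd; exists (fun l => (l == k)%:R); first by move=> l; rewrite ler0n.
rewrite (bigD1 (Ordinal kd)) //= eqxx mul1r big1 ?addr0 // => l lk.
by rewrite (_ : (l == k :> nat) = false) ?mul0r //; apply: negPf.
Qed.

(** To fill the plane, the cone thus needs only all real constants and, modulo constants, both signs
    of [u - 1]. *)
Lemma complex_line_decomp u z :
  complex.Im u != 0 -> exists a b : R, z = a%:C + b%:C * (u - 1).
Proof.
case: u z => x y [s t] /= y0.
exists (s - t / y * (x - 1)), (t / y).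
by apply/eqP; rewrite eq_complex /=; apply/andP; split; apply/eqP; field.
Qed.

(* With [w = u ^+ k] in the closed left half-plane, the identity
   [w ^+ 2 - 2 (Re w) w = - `|w| ^+ 2] puts a negative real in the cone. *)
Lemma power_cone_full u :
  complex.Im u != 0 -> 9 <= complex.Re u ^+ 2 + complex.Im u ^+ 2 ->
  exists d, forall z, power_cone d u z.
Proof.
move=> Iu0 u9; have [k Rk] := exists_expr_Re_le0 Iu0.
pose w := u ^+ k; pose r := - complex.Re w.
pose s := complex.Re w ^+ 2 + complex.Im w ^+ 2.
have r0 : 0 <= r by rewrite oppr_ge0.
have k0 : (0 < k)%N.
  by case: k Rk {w r s r0} => // Rk; move: Rk; rewrite expr0 /= ler10.
have s9 : 9 <= s.
  rewrite -lecR add_Re2_Im2 normrX -exprM mulnC exprM -add_Re2_Im2.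
  rewrite -rmorphXn /= lecR.
  case: k k0 {Rk w r s r0} => // k _; rewrite exprS.
  have : 1 <= (complex.Re u ^+ 2 + complex.Im u ^+ 2) ^+ k.
    by apply: exprn_ege1; lra.
  nra.
have rs : r ^+ 2 <= s by rewrite sqrrN lerDl sqr_ge0.
have wE : w ^+ 2 + (2 * r)%:C * w = - s%:C.
  rewrite /r /s; case: (w) => x y; rewrite expr2.
  by apply/eqP; rewrite eq_complex /=; apply/andP; split; apply/eqP; ring.
(* [B] is the coefficient sum of [w ^+ 2 + 2 r w], lost when each power [u ^+ e] is replaced by
   [u ^+ e - 1]. *)
pose B := 1 + 2 * r.
have B0 : 0 < B by rewrite /B; lra.
have BE : B%:C = 1 + (2 * r)%:C by rewrite rmorphD.
have Bs : B < s by rewrite /B; nra.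
exists (4 * k).+2.
have P e : (e <= (4 * k).+1)%N -> power_cone (4 * k).+2 u (u ^+ e - 1).
  by move=> le_e; apply: power_cone_expr.
have r2 : 0 <= 2 * r by lra.
have negc : power_cone (4 * k).+2 u (- (s + B)%:C).
  have -> : - (s + B)%:C =
      (u ^+ (k * 2) - 1) + (2 * r)%:C * (u ^+ k - 1).
    by rewrite exprM -/w rmorphD /= opprD -wE BE; ring.
  by apply: power_coneD; [|apply: power_coneZ => //]; apply: P; lia.
(* Squaring [w ^+ 2 + 2 r w = - s] gives value [s ^+ 2] with coefficient sum [B ^+ 2]; the
   difference is positive as [B < s]. *)
have posc : power_cone (4 * k).+2 u (s ^+ 2 - B ^+ 2)%:C.
  have -> : (s ^+ 2 - B ^+ 2)%:C =
      (u ^+ (k * 4) - 1) + (2 * (2 * r))%:C * (u ^+ (k * 3) - 1)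
       + ((2 * r) ^+ 2)%:C * (u ^+ (k * 2) - 1).
    rewrite !exprM -/w rmorphB /= rmorphXn /= -(sqrrN s%:C) -wE rmorphXn /= BE.
    by rewrite [(2 * (2 * r))%:C]rmorphM /= rmorph_nat rmorphXn /=; ring.
  apply: power_coneD; [apply: power_coneD|];
    [|apply: power_coneZ|apply: power_coneZ];
    rewrite ?sqr_ge0 ?mulr_ge0 //; apply: P; lia.
have const (c : R) : power_cone (4 * k).+2 u c%:C.
  have [c0 | c0] := leP 0 c.
    have D0 : 0 < s ^+ 2 - B ^+ 2 by nra.
    rewrite -[c](divfK (lt0r_neq0 D0)) rmorphM /=.
    by apply: power_coneZ => //; rewrite divr_ge0 // ltW.
  have D0 : 0 < s + B by lra.
  have -> : c%:C = (- c / (s + B))%:C * - (s + B)%:C.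
    by rewrite -rmorphN -rmorphM /=; congr (_%:C); field; exact: lt0r_neq0.
  by apply: power_coneZ => //; rewrite divr_ge0 // ltW // oppr_gt0.
move=> z; have [a [b ->]] := complex_line_decomp z Iu0.
have [b0 | b0] := leP 0 b.
  apply: power_coneD => //; apply: power_coneZ => //.
  by rewrite -[u in X in power_cone _ _ X]expr1; apply: P.
(* Multiplying the same identity by [u] reaches the direction [- u]. *)
have negu : power_cone (4 * k).+2 u (- s%:C * u - B%:C).
  have -> : - s%:C * u - B%:C =
      (u ^+ (k * 2).+1 - 1) + (2 * r)%:C * (u ^+ k.+1 - 1).
    by rewrite -wE BE !exprSr exprM -/w; ring.
  by apply: power_coneD; [|apply: power_coneZ => //]; apply: P; lia.
have s0 : s != 0 by rewrite gt_eqF //; lra.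
pose c := - b / s.
have -> : a%:C + b%:C * (u - 1) =
    (a - b + c * B)%:C + c%:C * (- s%:C * u - B%:C).
  have -> : b = - (c * s) by rewrite /c divfK // opprK.
  by rewrite !(rmorphD, rmorphM, rmorphN) /=; ring.
apply: power_coneD => //; apply: power_coneZ => //.
by rewrite /c divr_ge0; lra.
Qed.

End ComplexPowers.

(** [|p.[x]|] is the product of the [n] distances from [x] to the roots; if all were at least [r],
    it would be at least [r ^+ n]. *)
Lemma monic_root_near (F : numClosedFieldType) (p : {poly F}) (x r : F) n :
  (p \is monic -> size p = n.+1 -> 0 <= r -> `|p.[x]| < r ^+ n ->
  exists2 y, root p y & `|x - y| < r)%R.
Proof.
move=> /monicP p1; have [s ps] := closed_field_poly_normal p.
rewrite ps p1 scale1r size_prod_XsubC => -[<-] r0.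
have [/hasP[y ys xy] _ | /hasPn far] := boolP (has (fun y => `|x - y| < r)%R s).
  by exists y => //; rewrite root_prod_XsubC.
rewrite horner_prod normr_prod => small; exfalso; move: small; apply/negP.
rewrite -real_leNgt ?ger0_real ?exprn_ge0 ?prodr_ge0 //.
elim: s far {ps p1} => [|y s IH] far; first by rewrite big_nil.
rewrite big_cons exprS hornerXsubC ler_pM ?exprn_ge0 ?IH //.
  by have := far y (mem_head _ _); rewrite -real_leNgt ?ger0_real.
by move=> z zs; apply: far; rewrite inE zs orbT.
Qed.

(** * Density of the roots *)

Section Roots.
Local Open Scope ring_scope.
Local Open Scope complex_scope.

(** [v] is a root of a polynomial [Q] near [u], and [q] is [Q] composed with [p]. *)
Lemma face_poly_root_near (R : realType) (u : R[i]) :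
  complex.Im u != 0 -> 9 <= complex.Re u ^+ 2 + complex.Im u ^+ 2 ->
  exists2 v : R[i], `|u - v| < 2 & forall p : {poly R[i]},
    is_face_poly p -> exists2 q, is_face_poly q &
      forall z, p.[z] = v -> root q z.
Proof.
move=> Iu0 u9; have [d cone] := power_cone_full Iu0 u9.
pose M := \sum_(k < d) `|u ^+ k - 1|.
have M0 : 0 <= M by rewrite sumr_ge0.
have /complex_realP[M' M'E] : M \is Num.real by rewrite ger0_real.
(* [d] and [M] do not depend on [j]. Taking [j >= d] makes [Q] monic of degree [j]; the other bound
   gives [M < 2 ^+ j]. *)
pose j := maxn d (Num.bound M').
have ltM : M < 2 ^+ j.
  rewrite M'E -(rmorph_nat (real_complex R) 2) -rmorphXn /= ltcR.
  by apply: upper_nthrootP; apply: leq_maxr.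
have [a a0 aE] := cone (- u ^+ j).
pose n k := Num.truncn (a k).
pose Q : {poly R[i]} := 'X^j + \sum_(k < d) (n k)%:R * ('X^k - 1).
have lowQ : (size (\sum_(k < d) (n k)%:R * ('X^k - 1) : {poly R[i]})%R
             < size ('X^j : {poly R[i]})%R)%N.
  rewrite size_polyXn ltnS; apply: leq_trans (leq_maxl _ _).
  apply: (leq_trans (size_sum _ _ _)); apply/bigmax_leqP => k _.
  rewrite mulr_natl -scaler_nat; apply: leq_trans (size_scale_leq _ _) _.
  rewrite (leq_trans (size_polyD _ _)) // geq_max size_polyXn size_polyN.
  by rewrite size_poly1 ltn_ord (leq_ltn_trans _ (ltn_ord k)).
have Qmonic : Q \is monic by rewrite monicE lead_coefDl // lead_coefXn.
have sQ : size Q = j.+1 by rewrite size_polyDl // size_polyXn.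
have QE z : Q.[z] = z ^+ j + \sum_(k < d) (n k)%:R * (z ^+ k - 1).
  rewrite hornerD hornerXn horner_sum; congr (_ + _); apply: eq_bigr => k _.
  by rewrite mulr_natl hornerMn hornerD hornerN hornerXn hornerC mulr_natl.
(* With the coefficients [a k] the value at [u] is 0; rounding each down by at most 1 moves it by at
   most [M]. *)
have Qu : `|Q.[u]| < 2 ^+ j.
  apply: le_lt_trans ltM; rewrite QE -[u ^+ j]opprK aE -sumrN -big_split /=.
  apply: (le_trans (ler_norm_sum _ _ _)); apply: ler_sum => k _.
  rewrite -mulNr -mulrDl normrM ler_piMl //.
  rewrite -(rmorph_nat (real_complex R)) -rmorphN -rmorphD /= normc_def /=.
  have /andP[] := truncn_itv (a0 k); rewrite -/(n k) -natr1 => n1 n2.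
  rewrite expr0n addr0 sqrtr_sqr -(rmorph1 (real_complex R)) lecR.
  by rewrite ler_norml; apply/andP; split; lra.
have [v rootv uv] := monic_root_near Qmonic sQ (ler0n _ 2) Qu.
exists v => // p pF.
exists (p ^+ j + \sum_(k < d) (n k)%:R * (p ^+ k - 1)).
  by apply: is_face_poly_sum => [|k]; apply: is_face_polyX.
move=> z pz; apply/rootP; rewrite -(rootP rootv) QE.
rewrite hornerD horner_exp pz horner_sum; congr (_ + _); apply: eq_bigr => k _.
by rewrite mulr_natl hornerMn hornerD hornerN horner_exp pz hornerC mulr_natl.
Qed.

Lemma face_poly_Rel_root (R : realType) (p : {poly R[i]}) z :
  is_face_poly p -> root p z ->
  exists (X : finType) (C : {set {set X}}),
    [/\ (0 < #|X|)%N, simplicial_complex C, shellable C & root (Rel R[i] C) z].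
Proof.
move=> [V [D [V0 DP D0 <-]]] rootz; exists (V + V)%type, (whisker D); split.
- by rewrite card_sum addn_gt0 V0.
- exact: whisker_complex.
- exact: whisker_shellable.
- by apply/rootP; rewrite Rel_whisker hornerM (rootP rootz) mulr0.
Qed.

Lemma face_poly_root_dense (R : realType) (z e : R[i]) :
  complex.Im z != 0 -> 0 < e ->
  exists2 y, `|z - y| < e & exists2 p : {poly R[i]}, is_face_poly p & root p y.
Proof.
case: z => x y /= y0 e0.
have /complex_realP[r rE] : e \is Num.real by rewrite gtr0_real.
rewrite {}rE ltcR in e0 *.
(* The first bound gives [2 / m < r], the second [9 < m * y ^+ 2 <= (m * y) ^+ 2]. *)
pose m := maxn (Num.bound (2 / r)) (Num.bound (9 / y ^+ 2)).
have y2 : 0 < y ^+ 2 by rewrite exprn_even_gt0.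
have m1 : 2 / r < m%:R.
  apply: lt_le_trans (archi_boundP _) _; first by rewrite divr_ge0 // ltW.
  by rewrite ler_nat leq_maxl.
have m2 : 9 / y ^+ 2 < m%:R.
  apply: lt_le_trans (archi_boundP _) _; first by rewrite divr_ge0 // ltW.
  by rewrite ler_nat leq_maxr.
have m0 : 0 < m%:R :> R by apply: le_lt_trans m1; rewrite divr_ge0 // ltW.
have m1' : 1 <= m%:R :> R by rewrite ler1n; rewrite ltr0n in m0.
rewrite ltr_pdivrMr // in m1; rewrite ltr_pdivrMr // in m2.
have [||v uv vF] := @face_poly_root_near R ((1 + m%:R * x) +i* (m%:R * y)).
- by rewrite /= mulf_neq0 // gt_eqF.
- rewrite /= [(_ * y) ^+ 2]exprMn.
  have := sqr_ge0 (1 + m%:R * x); nra.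
have [p pF rootp] := vF _ (is_face_poly_points R[i] m).
have mE : m%:R = (m%:R : R)%:C by rewrite rmorph_nat.
have mC : m%:R != 0 :> R[i] by rewrite mE fmorph_eq0 gt_eqF.
exists ((v - 1) / m%:R); last first.
  exists p => //; apply: rootp.
  by rewrite hornerD hornerC hornerZ hornerX mulrC divfK // addrC subrK.
have -> : x +i* y - (v - 1) / m%:R =
    (((1 + m%:R * x) +i* (m%:R * y)) - v) / m%:R.
  have -> : ((1 + m%:R * x) +i* (m%:R * y)) = 1 + m%:R * (x +i* y).
    rewrite mE; apply/eqP; rewrite eq_complex /=.
    by apply/andP; split; apply/eqP; ring.
  by field.
rewrite normrM normfV ltr_pdivrMr ?normr_gt0 // (lt_trans uv) //.
rewrite normr_nat mE -rmorphM /= -(rmorph_nat (real_complex R) 2) ltcR.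
by rewrite mulrC.
Qed.
End Roots.

(* R[i]^o is R[i] equipped with the topology of its modulus. *)
Theorem theorem2 (R : realType) :
  dense [set q : R[i]^o |
    exists (X : finType) (C : {set {set X}}),
      [/\ 0 < #|X|, simplicial_complex C, shellable C
        & root (Rel R[i] C) q]]%classic.
Proof.
move=> O [z0 Oz0] openO.
have ballO (z : R[i]^o) : O z -> exists2 e : R[i], (0 < e)%R &
    forall y : R[i], (`|z - y| < e)%R -> O y.
  move=> Oz; have /nbhs_ballP[e /= e0 eO] : nbhs z O by apply: open_nbhs_nbhs.
  by exists e => // y zy; apply: eO; rewrite -ball_normE.
(* A real point of [O] is shifted vertically by half the radius of a ball inside [O]. *)
have [z Oz Iz] : exists2 z : R[i], O z & complex.Im z != 0%R.
  have [Iz | Iz] := eqVneq (complex.Im (z0 : R[i])) 0%R; last by exists z0.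
  have [e e0 eO] := ballO _ Oz0.
  have /complex_realP[r rE] : e \is Num.real by rewrite gtr0_real.
  rewrite {}rE ltcR in e0 eO.
  exists (z0 - (0 +i* (r / 2))%C)%R.
    apply: eO; rewrite opprB addrC subrK normc_def /= expr0n add0r sqrtr_sqr.
    by rewrite ltcR ger0_norm; lra.
  case: (z0 : R[i]) Iz => x y /= ->; rewrite sub0r oppr_eq0.
  by rewrite gt_eqF // divr_gt0.
have [e e0 eO] := ballO _ Oz.
have [y zy [p pF rooty]] := face_poly_root_dense Iz e0.
by exists y; split; [exact: eO | exact: face_poly_Rel_root pF rooty].
Qed.
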